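(* Let $k$ be a positive integer and let $i$ be an integer with $0 \leq i \leq k$. Then $$\sum_{\substack{0 \leq m \leq \min\{i,k-i\} \\ 1 \leq n \leq k-i}} (-1)^n 2^{n-m} \binom{k+1}{i-m} \binom{k}{i+n}\binom{n-1}{m} = (-1)^{k-i} \binom{k}{i} - \binom{k}{i}^2,$$ where the sum is over integers $m,n$ in the indicated ranges.
   Context: Binomial coefficients are the usual ones; for integers $a\ge 0$ and $b$, $\binom{a}{b}=0$ if $b<0$ or $b>a$. An empty sum is $0$. *)

(* Defs.v *)
From mathcomp Require Export all_boot all_order all_algebra.

(* Main.v *)
Require Import Defs.
From mathcomp Require Import all_boot all_order all_algebra.
From mathcomp Require Import ring zify.
Import GRing.Theory.
Local Open Scope ring_scope.

(** Write the sum over [m] as a coefficient extraction.  Since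
    [2 ^ (n - 1 - m) * 'C(n.-1, m)] is the coefficient of ['X^m] in
    [(2 + 'X) ^+ n.-1], the left-hand side is twice the coefficient of ['X^i] in
<<
      (1 + X)^(k+1) * \sum_(n >= 1) (-1)^n 'C(k, i + n) (2 + X)^(n-1).
>>
    The inner sum is, up to sign, the tail of the binomial expansion of
    [(1 + w)^k] at [w = - (2 + X)], divided by [w^(i+1)].  Such a tail can be
    re-expanded in powers of [1 + w] ([binomial_tail]), and here
    [1 + w = - (1 + X)], so everything collapses to powers of [1 + X].  The
    left-hand side becomes
<<
      2 * \sum_(l < k) (-1)^(k-l) 'C(l, i) 'C(2k - l, i).
>>
    The summand is invariant under [l -> 2k - l], so this is the sum over all
    [l <= 2k] minus its middle term ['C(k, i) ^+ 2].  The full sum is a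
    coefficient of [(-x)^i / (1 + x)^(i+1) * x^i / (1 - x)^(i+1)
    = (- x^2)^i / (1 - x^2)^(i+1)], whence its value up to sign ['C(k, i)]
    ([alt_conv_diag]). *)

(** * Alternating convolutions of binomial coefficients *)

Definition alt_conv (R : comNzRingType) (N i j : nat) : R :=
  \sum_(l < N.+1) (-1) ^+ l * 'C(l, i)%:R * 'C(N - l, j)%:R.

(** The generating series of [alt_conv R N i j] in [N] has a factor
    [1 / (1 - x)^(j+1)]; multiplying it by [1 - x] lowers [j]. *)
Lemma alt_convSr (R : comNzRingType) (N i j : nat) :
  alt_conv R N.+1 i j.+1 = alt_conv R N i j.+1 + alt_conv R N i j.
Proof.
rewrite /alt_conv big_ord_recr /= subnn bin0n mulr0 addr0 -big_split /=.
by apply: eq_bigr => l _; rewrite subSn -1?ltnS // binS natrD mulrDr.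
Qed.

(** Symmetrically, multiplying the generating series by [1 + x] lowers [i]. *)
Lemma alt_convSl (R : comNzRingType) (N i j : nat) :
  alt_conv R N.+1 i.+1 j = - alt_conv R N i.+1 j - alt_conv R N i j.
Proof.
rewrite /alt_conv big_ord_recl /= bin0n mulr0 mul0r add0r -opprD -big_split /=.
rewrite -sumrN; apply: eq_bigr => l _.
rewrite /bump /= add1n subSS binS natrD exprS; ring.
Qed.

(** The two recurrences combine to multiplication by [1 - x^2], which is
    Pascal's rule for ['C(k, i)] with a sign. *)
Lemma alt_conv_diag (R : comNzRingType) (k i : nat) :
  alt_conv R k.*2 i i = (-1) ^+ i * 'C(k, i)%:R.
Proof.
elim: k i => [|k IHk] [|i].
- by rewrite /alt_conv big_ord1 !bin0 !mulr1 ?expr0.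
- by rewrite /alt_conv big_ord1 !bin0n !mulr0.
- rewrite doubleS /alt_conv 2!big_ord_recr /= bin0.
  have IH0 := IHk 0; rewrite /alt_conv !bin0 in IH0.
  rewrite -IH0 -addrA -[RHS]addr0; congr (_ + _).
    by apply: eq_bigr => l _; rewrite !bin0.
  by rewrite !bin0 !exprS; ring.
- rewrite doubleS alt_convSl alt_convSl !alt_convSr !IHk binS natrD exprS.
  by ring.
Qed.

(** The reflection [l -> 2k - l] fixes the index [k] and exchanges the two
    halves; it preserves the sign because [2k] is even. *)
Lemma alt_conv_fold (R : comNzRingType) (k i : nat) :
  alt_conv R k.*2 i i
  = (\sum_(l < k) (-1) ^+ l * 'C(l, i)%:R * 'C(k.*2 - l, i)%:R) *+ 2
    + (-1) ^+ k * 'C(k, i)%:R ^+ 2.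
Proof.
pose f l : R := (-1) ^+ l * 'C(l, i)%:R * 'C(k.*2 - l, i)%:R.
have fsym l : (l <= k.*2)%N -> f (k.*2 - l)%N = f l.
  move=> le_l; rewrite /f subKn // mulrAC; congr (_ * _ * _).
  by rewrite -signr_odd oddB // odd_double signr_odd.
rewrite /alt_conv -!(big_mkord xpredT f).
rewrite (@big_cat_nat _ _ _ k) //=; last by lia.
rewrite [X in _ + X]big_ltn; last by lia.
rewrite [X in _ + (_ + X)]big_nat_rev -{1}[k.+1]add0n big_addn.
rewrite (_ : k.*2.+1 - k.+1 = k)%N; last by lia.
have -> : \sum_(0 <= l < k) f (k.+1 + k.*2.+1 - (l + k.+1).+1)%N
    = \sum_(0 <= l < k) f l.
  rewrite !big_mkord; apply: eq_bigr => l _; have lt_lk := ltn_ord l.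
  by rewrite -[RHS]fsym; [congr f|]; lia.
rewrite mulr2n [f k + _]addrC addrA; congr (_ + _).
by rewrite /f -addnn addnK expr2 mulrA.
Qed.

(** * Tails of the binomial expansion *)

(** The left-hand side is [((1 + w)^k - \sum_(j <= i) 'C(k, j) w^j) / w^(i+1)].
    By Pascal's rule both sides obey [F(k+1) = (1 + w) F(k) + 'C(k, i)].  The
    terms with [i + n >= k], resp. [l < i], are zero. *)
Lemma binomial_tail (R : comNzRingType) (w : R) (k i : nat) :
  \sum_(n < k) 'C(k, i.+1 + n)%:R * w ^+ n
  = \sum_(l < k) 'C(l, i)%:R * (1 + w) ^+ (k.-1 - l).
Proof.
elim: k => [|k IHk]; first by rewrite !big_ord0.
transitivity ((1 + w) * (\sum_(n < k) 'C(k, i.+1 + n)%:R * w ^+ n)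
              + 'C(k, i)%:R).
  under eq_bigr => n _ do rewrite addSn binS natrD mulrDl.
  rewrite big_split /= big_ord_recr /= bin_small; last by lia.
  rewrite mul0r addr0 mulrDl mul1r -addrA; congr (_ + _).
  rewrite big_ord_recl /= addn0 mulr1 addrC; congr (_ + _).
  rewrite mulr_sumr; apply: eq_bigr => n _.
  by rewrite /bump /= add1n addnS addSn exprS mulrCA.
rewrite IHk [RHS]big_ord_recr /= subnn mulr1; congr (_ + _).
rewrite mulr_sumr; apply: eq_bigr => l _.
rewrite mulrCA -exprS; congr (_ * _ ^+ _).
by have := ltn_ord l; lia.
Qed.

(** * Coefficient extraction *)

Lemma coef_addCX_exp (R : comNzRingType) (c : R) (n m : nat) :
  ((c%:P + 'X) ^+ n)`_m = c ^+ (n - m) * 'C(n, m)%:R.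
Proof.
rewrite exprDn coef_sum.
have coefE (j : 'I_n.+1) : ((c%:P ^+ (n - j) * 'X^j) *+ 'C(n, j))`_m
    = if (j == m :> nat) then c ^+ (n - m) * 'C(n, m)%:R else 0.
  rewrite coefMn -polyC_exp coefCM coefXn eq_sym.
  by case: eqP => [->|_] /=; rewrite ?mulr0 ?mul0rn // mulr1 mulr_natr.
under eq_bigr => j _ do rewrite coefE.
rewrite -big_mkcond /=.
have [le_mn|lt_nm] := leqP m n.
  by rewrite (big_pred1 (Ordinal (le_mn : (m < n.+1)%N))).
by rewrite bin_small // mulr0 big1.
Qed.

(** At [w = - (2 + 'X)] the quantity [1 + w] is [- (1 + 'X)], so re-expanding
    the tail in powers of [1 + w] merges it with the factor
    [(1 + 'X) ^+ k.+1] and each term becomes a single power of [1 + 'X]. *)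
Lemma coef_binomial_tail (R : comNzRingType) (k i : nat) :
  ((\sum_(n < k) 'C(k, i.+1 + n)%:R * (- (2%:P + 'X)) ^+ n)
     * (1%:P + 'X) ^+ k.+1 : {poly R})`_i
  = \sum_(l < k) (-1) ^+ (k.-1 - l) * 'C(l, i)%:R * 'C(k.*2 - l, i)%:R.
Proof.
have w1 : 1 + (- (2%:P + 'X)) = - (1%:P + 'X) :> {poly R}.
  by rewrite (_ : 2%:P = 1 + 1) ?polyCD; ring.
rewrite binomial_tail w1 mulr_suml coef_sum; apply: eq_bigr => l _.
set a := (k.-1 - l)%N.
have -> : 'C(l, i)%:R * (- (1%:P + 'X)) ^+ a * (1%:P + 'X) ^+ k.+1
    = ((-1) ^+ a * 'C(l, i)%:R)%:P * (1%:P + 'X) ^+ (k.*2 - l) :> {poly R}.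
  have -> : (k.*2 - l = a + k.+1)%N by rewrite /a; have := ltn_ord l; lia.
  rewrite exprD (exprNn (1%:P + 'X)) polyCM rmorphXn rmorphN rmorph1.
  by rewrite rmorph_nat; ring.
by rewrite coefCM coef_addCX_exp expr1n mul1r.
Qed.

Theorem theorem6p1 (k i : nat) (k_gt0 : (0 < k)%N) (le_ik : (i <= k)%N) :
  \sum_(0 <= m < (minn i (k - i)).+1) \sum_(1 <= n < (k - i).+1)
     (-1) ^+ n * 2 ^ (n%:Z - m%:Z)
       * 'C(k.+1, i - m)%:R * 'C(k, i + n)%:R * 'C(n.-1, m)%:R
  = (-1) ^+ (k - i) * 'C(k, i)%:R - 'C(k, i)%:R ^+ 2 :> rat.
Proof.
(* From here on [n] stands for the original [n - 1].  The range of [n] grows to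
   [n < k] by terms in which ['C(k, i + n.+1)] is zero, and that of [m] to
   [m <= i] by terms in which ['C(n, m)] is zero; [m] cannot go beyond [i],
   where [i - m] would be truncated to [0]. *)
transitivity
  (\sum_(m < i.+1) \sum_(n < k)
     - 2 * ((-1) ^+ n * 'C(k, i.+1 + n)%:R * ((2%:P + 'X) ^+ n)`_m
            * ((1%:P + 'X) ^+ k.+1)`_(i - m)) : rat).
  have inner (m : nat) : (m <= i)%N ->
      \sum_(1 <= n < (k - i).+1)
        ((-1) ^+ n * 2 ^ (n%:Z - m%:Z)
         * 'C(k.+1, i - m)%:R * 'C(k, i + n)%:R * 'C(n.-1, m)%:R : rat)
      = \sum_(n < k)
         - 2 * ((-1) ^+ n * 'C(k, i.+1 + n)%:R * ((2%:P + 'X) ^+ n)`_m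
                * ((1%:P + 'X) ^+ k.+1)`_(i - m)).
    move=> le_mi; rewrite big_add1 /= big_mkord.
    rewrite (big_ord_widen k (fun n => (-1) ^+ n.+1 * 2 ^ (n.+1%:Z - m%:Z)
      * 'C(k.+1, i - m)%:R * 'C(k, i + n.+1)%:R * 'C(n, m)%:R : rat));
      last by exact: leq_subr.
    rewrite big_mkcond; apply: eq_bigr => n _ /=.
    rewrite !coef_addCX_exp expr1n mul1r addSnnS.
    case: ltnP => [_|le_kin]; last first.
      by rewrite (@bin_small k) ?mulr0 ?mul0r ?mulr0 //; lia.
    have [le_mn|lt_nm] := leqP m n; last first.
      by rewrite (@bin_small n) // !(mulr0, mul0r).
    (* When [m <= n] the exponent is a natural number, and the factor [2] is
       what distinguishes it from the exponent [n - m] of the coefficient. *)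
    have -> : n.+1%:Z - m%:Z = (n - m).+1%:Z by lia.
    by rewrite -exprnP !exprS; ring.
  rewrite -(big_mkord xpredT (fun m => \sum_(n < k)
     - 2 * ((-1) ^+ n * 'C(k, i.+1 + n)%:R * ((2%:P + 'X) ^+ n)`_m
            * ((1%:P + 'X) ^+ k.+1)`_(i - m)))).
  rewrite [RHS](@big_cat_nat _ _ _ (minn i (k - i)).+1) //=; last by lia.
  rewrite [X in _ + X]big_nat_cond [X in _ + X]big1 ?addr0.
    by rewrite !big_nat; apply: eq_bigr => m lt_m; apply: inner; lia.
  move=> m; rewrite andbT => lt_m; apply: big1 => n _.
  rewrite coef_addCX_exp; have [le_kin|lt_nki] := leqP (k - i) n.
    by rewrite bin_small ?(mul0r, mulr0) //; lia.
  by rewrite (@bin_small n) ?(mul0r, mulr0) //; lia.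
rewrite exchange_big /=.
transitivity
  (- 2 * ((\sum_(n < k) 'C(k, i.+1 + n)%:R * (- (2%:P + 'X)) ^+ n)
          * (1%:P + 'X) ^+ k.+1)`_i : rat).
  rewrite mulr_suml coef_sum mulr_sumr; apply: eq_bigr => n _.
  rewrite -mulr_sumr; congr (_ * _).
  have -> : 'C(k, i.+1 + n)%:R * (- (2%:P + 'X)) ^+ n * (1%:P + 'X) ^+ k.+1
      = ((-1) ^+ n * 'C(k, i.+1 + n)%:R)%:P
        * ((2%:P + 'X) ^+ n * (1%:P + 'X) ^+ k.+1) :> {poly rat}.
    rewrite (exprNn (2%:P + 'X)) polyCM rmorphXn rmorphN rmorph1 rmorph_nat.
    by ring.
  rewrite coefCM coefM mulr_sumr; apply: eq_bigr => m _.
  by rewrite mulrA.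
rewrite coef_binomial_tail.
transitivity
  ((-1) ^+ k
   * ((\sum_(l < k) (-1) ^+ l * 'C(l, i)%:R * 'C(k.*2 - l, i)%:R) *+ 2) : rat).
  rewrite -[in RHS]mulr_natl [RHS]mulrCA mulNr -mulrN; congr (2 * _).
  rewrite -sumrN mulr_sumr; apply: eq_bigr => l _.
  have -> : (-1) ^+ k = - ((-1) ^+ (k.-1 - l) * (-1) ^+ l) :> rat.
    rewrite -exprD -[RHS]mulN1r -exprS.
    by congr (_ ^+ _); have := ltn_ord l; lia.
  transitivity (- ((-1) ^+ (k.-1 - l) * ((-1) ^+ l) ^+ 2 * 'C(l, i)%:R
                   * 'C(k.*2 - l, i)%:R) : rat); last by ring.
  by rewrite sqrr_sign mulr1.
have := alt_conv_fold rat k i; rewrite alt_conv_diag => fold.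
have -> : (-1) ^+ (k - i) = (-1) ^+ k * (-1) ^+ i :> rat.
  by rewrite -[in RHS](subnK le_ik) exprD -mulrA -expr2 sqrr_sign mulr1.
have -> : (\sum_(l < k) (-1) ^+ l * 'C(l, i)%:R * 'C(k.*2 - l, i)%:R) *+ 2
    = (-1) ^+ i * 'C(k, i)%:R - (-1) ^+ k * 'C(k, i)%:R ^+ 2 :> rat.
  by rewrite fold addrK.
rewrite mulrBr mulrA; congr (_ - _).
by rewrite mulrA -expr2 sqrr_sign mul1r.
Qed.
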